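(* (i) If $(\mathbf X^*,\mathbf y^* )\in\mathcal S_n\times\mathcal K$ is a saddle-point of $\min_{\mathbf X\in\mathcal S_n}\max_{\mathbf y\in\mathcal K}f(\mathbf X,\mathbf y)$, then $\mathbf X^*$ is an optimal solution of $\min_{\mathbf X\in\mathcal S_n}g(\mathbf X)$, $\nabla_{\mathbf X}f(\mathbf X^*,\mathbf y^* )\in\partial g(\mathbf X^* )$, and $\langle\mathbf X-\mathbf X^*,\nabla_{\mathbf X}f(\mathbf X^*,\mathbf y^* )\rangle\ge0$ for all $\mathbf X\in\mathcal S_n$. (ii) Conversely, suppose in addition that $g$ has the form $g(\mathbf X)=h(\mathbf X)+\max_{\mathbf y\in\mathcal K}\mathbf y^\top(\mathcal A(\mathbf X)-\mathbf b)$, where $h$ is smooth and convex, $\mathcal A$ is a linear map and $\mathbf b$ is a fixed vector, with $f(\mathbf X,\mathbf y)=h(\mathbf X)+\mathbf y^\top(\mathcal A(\mathbf X)-\mathbf b)$. If $\mathbf X^*$ is an optimal solution of $\min_{\mathbf X\in\mathcal S_n}g(\mathbf X)$ and $\mathbf G^*\in\partial g(\mathbf X^* )$ satisfies $\langle\mathbf X-\mathbf X^*,\mathbf G^*\rangle\ge0$ for all $\mathbf X\in\mathcal S_n$, then there exists $\mathbf y^*\in\arg\max_{\mathbf y\in\mathcal K}f(\mathbf X^*,\mathbf y)$ such that $(\mathbf X^*,\mathbf y^* )$ is a saddle-point of $\min_{\mathbf X\in\mathcal S_n}\max_{\mathbf y\in\mathcal K}f(\mathbf X,\mathbf y)$ and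 $\nabla_{\mathbf X}f(\mathbf X^*,\mathbf y^* )=\mathbf G^*$.
   Context: $\mathbb S^n$ is the space of real symmetric $n\times n$ matrices with inner product $\langle\mathbf A,\mathbf B\rangle=\mathrm{Tr}(\mathbf A\mathbf B)$; $\mathcal S_n=\{\mathbf X\in\mathbb S^n:\mathrm{Tr}(\mathbf X)=1,\mathbf X\succeq0\}$. $\mathbb V$ is a finite-dimensional real inner product space (with $\mathbf y^\top\mathbf u$ the inner product), $\mathcal K\subset\mathbb V$ is nonempty, compact and convex; $\mathcal A:\mathbb S^n\to\mathbb V$, $\mathbf b\in\mathbb V$. $f:\mathbb S^n\times\mathbb V\to\mathbb R$ is differentiable with $f(\cdot,\mathbf y)$ convex for all $\mathbf y\in\mathcal K$ and $f(\mathbf X,\cdot)$ concave on $\mathcal K$ for all $\mathbf X\in\mathcal S_n$; its partial gradients are Lipschitz in each argument over $\mathcal S_n\times\mathcal K$. The function $g:\mathbb S^n\to\mathbb R$ is $g(\mathbf X)=\max_{\mathbf y\in\mathcal K}f(\mathbf X,\mathbf y)$, a convex function, and $\partial g$ is its subdifferential. A saddle-point is $(\mathbf X^*,\mathbf y^* )\in\mathcal S_n\times\mathcal K$ with $f(\mathbf X^*,\mathbf y)\le f(\mathbf X^*,\mathbf y^* )\le f(\mathbf X,\mathbf y^* )$ for all $\mathbf X\in\mathcal S_n,\mathbf y\in\mathcal K$. *)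

(* Defs.v *)
From HB Require Import structures.
From mathcomp Require Import all_boot all_order all_algebra.
From mathcomp Require Import ring lra.
From mathcomp Require Import all_classical all_reals all_analysis.

Set Implicit Arguments.
Unset Strict Implicit.
Unset Printing Implicit Defensive.

Import Order.TTheory GRing.Theory Num.Theory.
Import numFieldNormedType.Exports.

Local Open Scope classical_set_scope.
Local Open Scope ring_scope.

(* Finite dimension comes from [Vector]; the topology, differentials and
   Lipschitz constants are those of the norm induced by the inner product. *)
HB.mixin Record isEuclidean (R : realType) V & NormedModule R V & Vector R V := {
  inner : {dot V for (@idfun R)};
  norm_inner : forall v : V, `|v| = Num.sqrt (inner v v)
}.

#[short(type="euclideanType")]
HB.structure Definition Euclidean (R : realType) :=
  {V of NormedModule R V & Vector R V & isEuclidean R V}.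

Section InnerNorm.
Context {R : realType} {V : vectType R} (ip : {dot V for (@idfun R)}).

Let nrm (v : V) := Num.sqrt (ip v v).

Lemma ip_ge0 v : 0 <= ip v v.
Proof.
have [->|v0] := eqVneq v 0; first by rewrite linear0l.
exact/ltW/neq0_dnorm_gt0.
Qed.

Lemma ipC u v : ip u v = ip v u.
Proof. by rewrite (@hermC R false idfun V ip) expr0 mul1r. Qed.

Lemma ip_expand a u v :
  ip (a *: u + v) (a *: u + v) = a ^+ 2 * ip u u + a * ip u v *+ 2 + ip v v.
Proof.
rewrite linearDl !linearDr !linearZl_LR !linearZr_LR /= (ipC v u); ring.
Qed.

Lemma ip_cauchy u v : ip u v <= nrm u * nrm v.
Proof.
have [u0|u0] := eqVneq u 0.
  by rewrite u0 linear0l mulr_ge0// sqrtr_ge0.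
have uu : 0 < ip u u by exact: neq0_dnorm_gt0.
apply: (le_trans (ler_norm _)).
rewrite -sqrtrM ?ip_ge0// -sqrtr_sqr ler_sqrt ?mulr_ge0 ?ip_ge0//.
have := ip_ge0 ((- (ip u v / ip u u)) *: u + v).
rewrite ip_expand => H.
have : 0 <= ip u u * ip v v - ip u v ^+ 2.
  have -> : ip u u * ip v v - ip u v ^+ 2 = ip u u *
     ((- (ip u v / ip u u)) ^+ 2 * ip u u + - (ip u v / ip u u) * ip u v *+ 2
      + ip v v) by field; rewrite gt_eqF.
  by rewrite mulr_ge0// ltW.
by rewrite subr_ge0.
Qed.

Lemma inner_normD u v : nrm (u + v) <= nrm u + nrm v.
Proof.
have uv : 0 <= nrm u + nrm v by rewrite addr_ge0// sqrtr_ge0.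
rewrite -[leRHS]ger0_norm// -sqrtr_sqr ler_sqrt ?sqr_ge0//.
have := ip_expand 1 u v; rewrite scale1r => ->.
rewrite sqrrD !sqr_sqrtr ?ip_ge0// expr1n !mul1r !lerD2r lerD2l.
by rewrite lerMn2r/= ip_cauchy.
Qed.

Lemma inner_normZ (l : R) v : nrm (l *: v) = `|l| * nrm v.
Proof.
rewrite /nrm linearZl_LR linearZr_LR /= mulrA -expr2.
by rewrite sqrtrM ?sqr_ge0// sqrtr_sqr.
Qed.

Lemma inner_norm0_eq0 v : nrm v = 0 -> v = 0.
Proof.
move=> /eqP; rewrite sqrtr_eq0 => h; apply/eqP; apply: contraTT h => v0.
by rewrite -ltNge; exact: neq0_dnorm_gt0.
Qed.

End InnerNorm.

HB.factory Record Vector_isEuclidean (R : realType) V & Vector R V := {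
  ip : {dot V for (@idfun R)}
}.

HB.builders Context R V & Vector_isEuclidean R V.

HB.instance Definition _ := @Lmodule_isNormed.Build R V
  (fun v => Num.sqrt (ip v v)) (inner_normD ip) (inner_normZ ip)
  (@inner_norm0_eq0 R V ip).

HB.instance Definition _ := @isEuclidean.Build R V ip (fun=> erefl).

HB.end.

Section SymmetricMatrices.
Context (R : realType) (n : nat).

Definition symmx_pred : {pred 'M[R]_n} := fun A => A \is symmetricmx.

Lemma symmx_predE (A : 'M[R]_n) : (A \in symmx_pred) = (A == A^T).
Proof.
rewrite [LHS]is_hermitianmxE expr0 scale1r; congr (A == _).
by apply/matrixP => i j; rewrite !mxE.
Qed.

Lemma symmx_submod_closed : GRing.submod_closed symmx_pred.
Proof.
split=> [|a A B]; rewrite !symmx_predE ?trmx0// => /eqP Asym /eqP Bsym.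
by rewrite linearP/= -Asym -Bsym.
Qed.

HB.instance Definition _ :=
  GRing.isSubmodClosed.Build R 'M[R]_n symmx_pred symmx_submod_closed.

(* The space of real symmetric matrices. Its norm is the Frobenius norm, not
   the max norm that MathComp-Analysis puts on ['M[R]_n]. *)
Record symmx : predArgType :=
  Symmx { symmx_val :> 'M[R]_n; _ : symmx_val \in symmx_pred }.

HB.instance Definition _ := [isSub for symmx_val].
HB.instance Definition _ := [Choice of symmx by <:].
HB.instance Definition _ := [SubChoice_isSubZmodule of symmx by <:].
HB.instance Definition _ := [SubZmodule_isSubLmodule of symmx by <:].

Lemma symmx_tr (A : symmx) : (A : 'M[R]_n)^T = A.
Proof. by case: A => A /=; rewrite symmx_predE => /eqP <-. Qed.

Let S := lker (linfun (@idfun 'M[R]_n \- trmx)).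

Let memS (A : 'M[R]_n) : (A \in S) = (A \in symmx_pred).
Proof. by rewrite memv_ker symmx_predE lfunE /= subr_eq0. Qed.

Let symmxP (A : symmx) : val A \in S. Proof. by rewrite memS (valP A). Qed.

Let subvs_symmx (A : subvs_of S) : vsval A \in symmx_pred.
Proof. by rewrite -memS subvsP. Qed.

Lemma symmx_vector_axiom : Vector.axiom (\dim S) symmx.
Proof.
have [phi phi_lin phi_bij] := subvs_vect_iso S.
exists (fun A : symmx => phi (vsproj S (val A))).
  by move=> a A B; rewrite (linearP val) (linearP (vsproj S)) phi_lin.
have [psi phiK psiK] := phi_bij.
exists (fun v => Sub (vsval (psi v)) (subvs_symmx (psi v)) : symmx) => [A|v].
  by apply/val_inj; rewrite /= phiK vsprojK.
by rewrite /= vsvalK psiK.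
Qed.

HB.instance Definition _ := Lmodule_hasFinDim.Build R symmx symmx_vector_axiom.

Definition trace_inner (A B : symmx) : R := \tr ((A : 'M[R]_n) *m B).

Let trace_innerC A B : trace_inner A B = (-1) ^+ false * idfun (trace_inner B A).
Proof. by rewrite expr0 mul1r /trace_inner mxtrace_mulC. Qed.

Let trace_inner_linear B : linear_for *%R (trace_inner^~ B).
Proof.
move=> a A A'; rewrite /trace_inner -[symmx_val (_ + _)]/(val _) (linearP val).
by rewrite mulmxDl -scalemxAl mxtraceD mxtraceZ.
Qed.

Let trace_inner_bilinear : bilinear_for *%R (idfun \; *%R) trace_inner.
Proof.
split=> [|B a A A'] /=; first exact: trace_inner_linear.
by rewrite !(trace_innerC B) expr0 !mul1r/= trace_inner_linear.
Qed.

HB.instance Definition _ := bilinear_isBilinear.Build R symmx symmx R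
  *%R (idfun \; *%R) trace_inner trace_inner_bilinear.
HB.instance Definition _ :=
  isHermitianSesquilinear.Build R symmx false idfun trace_inner trace_innerC.

Let trace_inner_gt0 (A : symmx) : A != 0 -> 0 < trace_inner A A.
Proof.
move=> A0.
have -> : trace_inner A A = \sum_i \sum_j (A : 'M[R]_n) i j ^+ 2.
  apply: eq_bigr => i _; rewrite mxE; apply: eq_bigr => j _.
  by rewrite -{2}(symmx_tr A) mxE expr2.
have sq i j : 0 <= (A : 'M[R]_n) i j ^+ 2 by exact: sqr_ge0.
rewrite lt_neqAle eq_sym sumr_ge0 ?andbT; last by move=> i _; exact: sumr_ge0.
apply: contra A0; rewrite psumr_eq0 => [/allP h|i _]; last exact: sumr_ge0.
apply/eqP/val_inj/matrixP => i j /=; rewrite [RHS]mxE; apply/eqP.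
rewrite -sqrf_eq0.
have := h i (mem_index_enum i); rewrite /= psumr_eq0// => /allP/(_ j).
by apply; rewrite mem_index_enum.
Qed.

HB.instance Definition _ :=
  isDotProduct.Build R symmx trace_inner trace_inner_gt0.

HB.instance Definition _ := Vector_isEuclidean.Build R symmx trace_inner.
End SymmetricMatrices.

(* Only used for symmetric [A]. *)
Definition psd (R : realType) n (A : 'M[R]_n) :=
  forall v : 'rV[R]_n, 0 <= (v *m A *m v^T) 0 0.

Definition spectraplex (R : realType) n : set (symmx R n) :=
  [set X | \tr (X : 'M[R]_n) = 1 /\ psd X].
Arguments spectraplex : clear implicits.

Section Gradients.
Context {R : realType}.

(* The Riesz representative of the differential; meaningful only where [phi]
   is differentiable. *)
Definition grad (V : euclideanType R) (phi : V -> R) (x : V) : V :=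
  get [set G | forall v, 'd phi x v = inner G v].

Context {U V : euclideanType R}.

Definition gradX (f : U -> V -> R) x y := grad (f ^~ y) x.
Definition gradY (f : U -> V -> R) x y := grad (f x) y.

(* Each partial gradient is Lipschitz in each of the two arguments, with a
   constant that does not depend on the other argument. *)
Definition lipschitz_partial_gradients (f : U -> V -> R)
    (A : set U) (B : set V) :=
  exists L : R,
    [/\ {in B, forall y, L.-lipschitz_A (gradX f ^~ y)},
        {in A, forall x, L.-lipschitz_B (gradX f x)},
        {in B, forall y, L.-lipschitz_A (gradY f ^~ y)} &
        {in A, forall x, L.-lipschitz_B (gradY f x)}].

(* Continuously differentiable. *)
Definition smooth (phi : V -> R) :=
  (forall x, differentiable phi x) /\ continuous (grad phi).

Definition subdifferential (g : V -> R) (x : V) : set V :=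
  [set G | forall z, g x + inner G (z - x) <= g z].

End Gradients.

Section Optimization.
Context {R : realType}.

(* The greatest element of [A]; meaningful only when [A] has one, as is the
   case of the image of a nonempty compact set by a continuous function. *)
Definition maximum (A : set R) : R := get (A `&` ubound A).

Definition argmin {T : Type} (A : set T) (phi : T -> R) : set T :=
  [set x | A x /\ forall z, A z -> phi x <= phi z].

Definition argmax {T : Type} (A : set T) (phi : T -> R) : set T :=
  [set x | A x /\ forall z, A z -> phi z <= phi x].

Definition saddle_point {T T' : Type} (A : set T) (B : set T')
    (f : T -> T' -> R) x y :=
  [/\ A x, B y &
    forall z w, A z -> B w -> f x w <= f x y /\ f x y <= f z y].

End Optimization.

(* Main.v *)
(* (i) The function [f ^~ ys] supports [g] from below at [Xs], so its gradient is
   a subgradient of [g]; minimality of [Xs] for [f ^~ ys] over the spectraplex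
   gives the variational inequality.

   (ii) Let s = g - h, i.e., s(X) = max_(y in K) <y, A X - b>, and G = Gs - grad h Xs.
   Along segments from Xs, s is convex and h is differentiable, so G is a
   subgradient of s at Xs. It remains to find y in K with A^T y = G and
   <b, y> = <G, Xs> - s(Xs). Otherwise the point (G, <G, Xs> - s(Xs)) lies
   outside the compact convex set {(A^T y, <b, y>) | y in K}, and its nearest
   point there yields a separating functional (Z, tau). As (Xs, -1) separates
   weakly, adding a multiple of it makes tau negative; after rescaling, the
   separation contradicts that G is a subgradient of s at Xs. *)

From HB Require Import structures.
Require Import Defs.
From mathcomp Require Import all_boot all_order all_algebra.
From mathcomp Require Import lra.
From mathcomp Require Import all_classical all_reals all_analysis.
Import Order.TTheory GRing.Theory Num.Theory.
Import numFieldNormedType.Exports.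
Local Open Scope classical_set_scope.
Local Open Scope ring_scope.

(** * Riesz representation, gradients and one-sided derivatives along segments *)

Section Euclidean.
Context {R : realType} {V : euclideanType R}.
Implicit Types (u v w x : V) (phi : V -> R).

Lemma innerBl u v w : inner (u - v) w = inner u w - inner v w.
Proof. exact: linearBl. Qed.

Lemma innerDr u v w : inner u (v + w) = inner u v + inner u w.
Proof. exact: linearDr. Qed.

Lemma innerBr u v w : inner u (v - w) = inner u v - inner u w.
Proof. exact: linearBr. Qed.

Lemma innerZr u v (a : R) : inner u (a *: v) = a * inner u v.
Proof. exact: linearZr_LR. Qed.

Lemma inner_continuous u : continuous (inner u).
Proof.
apply: (@bounded_linear_continuous R V R^o (inner u)).
apply/ex_bound; exists `|u|; near=> v.
change (`|inner u v : R| <= `|u|); rewrite ler_norml lerNl -linearNr /=.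
have vle w : `|w| <= 1 -> inner u w <= `|u|.
  move=> w1; apply: le_trans (ip_cauchy _ _ _) _.
  by rewrite -!norm_inner ler_piMr.
have v1 : `|v| <= 1.
  by near: v; exact: nbhs0_le.
by rewrite !vle// normrN.
Unshelve. all: by end_near. Qed.

Lemma eq_innerl u v : (forall w, inner u w = inner v w) -> u = v.
Proof.
move=> uv; apply/eqP; rewrite -subr_eq0; apply/negPn/negP => d0.
have := @neq0_dnorm_gt0 _ _ _ inner _ d0.
by rewrite innerBl uv subrr ltxx.
Qed.

(** The inner products with a basis determine a vector, so [L] is injective; its two sides have
    equal dimension, so it is onto, and a preimage of the values of [phi] on the basis represents
    [phi]. No orthonormal basis is built. *)
Lemma riesz (phi : {linear V -> R^o}) : exists G, forall v, phi v = inner G v.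
Proof.
pose e := vbasis {: V}.
pose L u : 'rV[R]_(\dim {: V}) := \row_i inner u e`_i.
have L_lin : linear L.
  by move=> a u v; apply/rowP => i; rewrite !mxE linearPl.
pose Lf : {linear V -> 'rV[R]_(\dim {: V})} :=
  HB.pack L (GRing.isLinear.Build _ _ _ _ L L_lin).
have ext (f g : {linear V -> R^o}) :
    (forall i : 'I_(\dim {:V}), f e`_i = g e`_i) -> f =1 g.
  move=> fg v; rewrite (coord_vbasis (memvf v)) !linear_sum.
  by apply: eq_bigr => i _; rewrite !linearZ fg.
have Lf_ker : lker (linfun Lf) == 0%VS.
  apply/lker0P => u v; rewrite !lfunE /= => /rowP uv.
  by apply/eq_innerl/ext => i; have := uv i; rewrite !mxE.
have /eqP Lf_img : limg (linfun Lf) == fullv.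
  rewrite eqEdim subvf /= limg_dim_eq ?(eqP Lf_ker) ?capv0//.
  by rewrite [leqLHS]dimvf dim_matrix mul1r.
have : \row_i phi e`_i \in limg (linfun Lf) by rewrite Lf_img memvf.
move=> /memv_imgP[G _]; rewrite lfunE => /rowP GE; exists G.
by apply: ext => i; have := GE i; rewrite !mxE.
Qed.

(** Riesz representatives are unique, so the choice made by [get] does not matter. *)
Lemma grad_eq {phi x} G : (forall v, 'd phi x v = inner G v) -> grad phi x = G.
Proof.
move=> GE; rewrite /grad; case: xgetP => [_ -> /= G'E|/(_ G)//].
by apply: eq_innerl => v; rewrite -G'E.
Qed.

Lemma gradE phi x v : 'd phi x v = inner (grad phi x) v.
Proof. by have [G GE] := riesz ('d phi x); rewrite (grad_eq G). Qed.

Lemma grad_add_affine phi G c x : differentiable phi x ->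
  grad (fun z => phi z + (inner G z + c)) x = grad phi x + G.
Proof.
move=> dphi; apply: grad_eq => v.
have dG : differentiable (inner G) x.
  exact/linear_differentiable/inner_continuous.
rewrite -[fun z => _]/(phi + (inner G + cst c)) diffD//=.
  rewrite diffD// diff_cst diff_lin; last exact: inner_continuous.
  by rewrite /= addr0 linearDl gradE.
exact: differentiableD.
Qed.

(** The derivative is the limit of its right difference quotients; only [t] in (0, 1) matters, the
    range that convexity on a segment controls. *)
Lemma diff_le phi x v c : differentiable phi x ->
    (forall t, 0 < t -> t < 1 -> phi (x + t *: v) - phi x <= t * c) ->
  'd phi x v <= c.
Proof.
move=> dphi le_c; rewrite -deriveE//.
have /cvg_dnbhs_at_right cv : derivable phi x v by exact: diff_derivable.
rewrite /derive -(cvg_lim _ cv)//.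
apply: limr_le; first by apply/cvg_ex; eexists; exact: cv.
near=> t; have t0 : 0 < t by [].
rewrite /= -ler_pdivlMl// ?invr_gt0 //.
by rewrite invrK [_ *: v + x]addrC le_c.
Unshelve. all: by end_near. Qed.

Lemma diff_ge phi x v c : differentiable phi x ->
    (forall t, 0 < t -> t < 1 -> t * c <= phi (x + t *: v) - phi x) ->
  c <= 'd phi x v.
Proof.
move=> dphi ge_c; rewrite -lerN2.
have <- : 'd (- phi) x v = - 'd phi x v by rewrite diffN.
apply: diff_le => [|t t0 t1]; first exact: differentiableN.
change (- phi (x + t *: v) - - phi x <= t * - c); have := ge_c t t0 t1; lra.
Qed.

Lemma convex_set_line (K : set V) x z t : convex_set K -> K x -> K z ->
  0 < t -> t < 1 -> K (x + t *: (z - x)).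
Proof.
move=> Kc Kx Kz t0 t1.
have /set_mem := Kc z x (Itv01 (ltW t0) (ltW t1)) (mem_set Kz) (mem_set Kx).
congr K; rewrite /conv /= /unstable.onem scalerBl scale1r scalerBr.
exact: addrCA.
Qed.

Lemma convex_function_line (K : set V) phi x z t :
    convex_function K phi -> K x -> K z -> 0 < t -> t < 1 ->
  phi (x + t *: (z - x)) - phi x <= t * (phi z - phi x).
Proof.
move=> phic Kx Kz t0 t1.
have := phic (Itv01 (ltW t0) (ltW t1)) z x (mem_set Kz) (mem_set Kx).
rewrite convRE /conv /= /unstable.onem scalerBl scale1r.
by rewrite [_ *: z + _]addrCA -scalerBr; lra.
Qed.

Lemma convex_gradient_le phi x z : convex_function setT phi ->
  differentiable phi x -> phi x + inner (grad phi x) (z - x) <= phi z.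
Proof.
move=> phic dphi; rewrite -gradE addrC -lerBrDr.
by apply: diff_le => // t; exact: (@convex_function_line setT).
Qed.

(** Coordinates in a basis are inner products with fixed vectors, hence continuous. *)
Lemma euclidean_linear_continuous (W : normedModType R)
  (T : {linear V -> W}) : continuous T.
Proof.
pose e := vbasis {: V}.
have coordC i : continuous (coord e i : V -> R).
  have [G GE] := riesz (coord e i : {linear V -> R^o}).
  have -> : (coord e i : V -> R) = inner G by exact/funext.
  exact: inner_continuous.
have -> : T = (fun v => \sum_i coord e i v *: T e`_i) :> (V -> W).
  apply/funext => v; rewrite {1}(coord_vbasis (memvf v)) linear_sum.
  by apply: eq_bigr => i _; rewrite linearZ.
move=> v; apply: cvg_big => [|i _]; first exact: add_continuous.
apply: cvgZr_tmp; exact: (coordC i v).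
Qed.

End Euclidean.

(** * Adjoints, separation, and subgradients of maxima of affine functions *)

Lemma adjoint_exists {R : realType} {U V : euclideanType R} (A : {linear U -> V}) :
  exists T : {linear V -> U}, forall y x, inner (T y) x = inner y (A x).
Proof.
have ex y : exists G, forall x, inner y (A x) = inner G x.
  exact: (riesz (inner y \o A)).
have [T TE] := choice ex.
have T_lin : linear T.
  by move=> a u v; apply: eq_innerl => x; rewrite -TE !linearPl /= -!TE.
pose Tlin : {linear V -> U} := HB.pack T (GRing.isLinear.Build _ _ _ _ T T_lin).
by exists Tlin => y x; rewrite TE.
Qed.

Lemma convex_image_separation {R : realType} {U V : euclideanType R}
    (K : set V) (T : {linear V -> U}) (P : U) (c : V) (beta : R) :
    K !=set0 -> compact K -> convex_set K ->
    (exists y, [/\ K y, T y = P & inner c y = beta]) \/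
    (exists Z tau, forall y, K y ->
      inner (T y) Z + tau * inner c y < inner P Z + tau * beta).
Proof.
move=> K0 Kcpt Kconv.
(* Squared distance from (T y, <c, y>) to (P, beta) in the product of [U] and the reals. *)
pose q y := `|T y - P| ^+ 2 + (inner c y - beta) ^+ 2.
have qC : continuous q.
  move=> y; apply: cvgD.
    apply: (cvg_comp _ (fun r : R => r ^+ 2)); last exact: exprn_continuous.
    apply: cvg_norm; apply: cvgB; last exact: cvg_cst.
    exact: euclidean_linear_continuous.
  apply: (cvg_comp _ (fun r : R => r ^+ 2)); last exact: exprn_continuous.
  apply: cvgB; last exact: cvg_cst.
  exact: inner_continuous.
have [|m /set_mem Km qm] := compact_EVT_min K0 Kcpt (f := q).
  exact: continuous_subspaceT.
have qE y : q y = inner (T y - P) (T y - P) + (inner c y - beta) ^+ 2.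
  by rewrite /q norm_inner sqr_sqrtr ?ip_ge0.
set r := T m - P; set rho := inner c m - beta.
have r_ge0 : 0 <= inner r r by exact: ip_ge0.
have [qm0|qm_neq0] := eqVneq (q m) 0.
  left; exists m; move: qm0; rewrite qE -/r -/rho => /eqP.
  rewrite paddr_eq0 ?sqr_ge0// sqrf_eq0 subr_eq0 => /andP[r0 /eqP rho0].
  split=> //; apply/eqP; rewrite -subr_eq0 -/r -normr_eq0 norm_inner.
  by rewrite (eqP r0) sqrtr0.
(* The functional is the inner product with the vector from the target to its nearest point, negated
   to get the required sign. *)
right; exists (- r), (- rho) => y Ky.
set d := T (y - m); set e := inner c (y - m).
(* Minimality of [m] gives q(m) <= q(m + t(y - m)); expand and divide by [t]. *)
have step t : 0 < t -> t < 1 ->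
    0 <= 2 * (inner d r + e * rho) + t * (inner d d + e ^+ 2).
  move=> t0 t1.
  have := qm _ (mem_set (convex_set_line _ _ _ _ Kconv Km Ky t0 t1)).
  rewrite !qE -/r -/rho.
  have -> : T (m + t *: (y - m)) - P = t *: d + r.
    by rewrite linearD linearZ /= addrAC addrC.
  have -> : inner c (m + t *: (y - m)) - beta = t * e + rho.
    by rewrite innerDr innerZr addrAC addrC.
  rewrite ip_expand => H.
  rewrite -(pmulr_rge0 _ t0); lra.
have dr_ge0 : 0 <= inner d r + e * rho.
  (* In place of a limit at 0, t = -a / (b + 1 - a) gives t b <= -a, hence 2 a + t b <= a < 0,
     against [step]. The 1 keeps t < 1 even if b = 0. *)
  rewrite leNgt; apply/negP => neg.
  set a := inner d r + e * rho in step neg.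
  set b := inner d d + e ^+ 2 in step.
  have b0 : 0 <= b by rewrite addr_ge0 ?ip_ge0 ?sqr_ge0.
  have ab : 0 < b + 1 - a by lra.
  have t0 : 0 < - a / (b + 1 - a) by rewrite divr_gt0 ?oppr_gt0.
  have t1 : - a / (b + 1 - a) < 1 by rewrite ltr_pdivrMr// mul1r; lra.
  have := step _ t0 t1.
  have : - a / (b + 1 - a) * b <= - a.
    rewrite mulrAC ler_pdivrMr//; nra.
  lra.
have qm_gt0 : 0 < inner r r + rho ^+ 2.
  by rewrite -qE lt_neqAle eq_sym qm_neq0 qE addr_ge0 ?sqr_ge0.
have Ty : inner (T y) r = inner d r + inner r r + inner P r.
  have -> : T y = d + r + P by rewrite /d linearB /r addrA !subrK.
  by rewrite !linearDl.
have cy : inner c y = e + rho + beta by rewrite /e innerBr /rho; lra.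
rewrite !linearNr /= Ty cy; lra.
Qed.

Lemma support_subgradient {R : realType} {U V : euclideanType R}
    (K : set V) (A : {linear U -> V}) (b : V) (s : U -> R) (X G : U) :
    K !=set0 -> compact K -> convex_set K ->
    (forall Z, exists2 y, K y & s Z = inner y (A Z - b)) ->
    (forall Z y, K y -> inner y (A Z - b) <= s Z) ->
    subdifferential s X G ->
  exists y, [/\ K y, inner y (A X - b) = s X &
                forall v, inner y (A v) = inner G v].
Proof.
move=> K0 Kcpt Kconv s_att s_ub GX.
have [T TE] := adjoint_exists A.
have sE y Z : inner y (A Z - b) = inner (T y) Z - inner b y.
  by rewrite innerBr -TE (ipC _ b).
(* Once T y = G, the equation <b, y> = <G, X> - s(X) says exactly that [y] attains s(X). *)
have [[y [Ky Ty cy]]|[Z [tau sep]]] :=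
  convex_image_separation _ T G b (inner G X - s X) K0 Kcpt Kconv.
  exists y; split=> // [|v]; last by rewrite -TE Ty.
  by rewrite sE Ty cy; lra.
(* Adding [kappa] times the weak inequality [s_ub] at [X] turns the coefficient [tau] into [- mu],
   and [kappa] is chosen so that mu >= 1. Dividing by [mu] gives <T y, W> - <b, y> < s(X) + <G, W -
   X> on [K]; a [y] attaining s(W) then violates the subgradient inequality. *)
pose kappa := Num.max 0 (tau + 1); pose mu := kappa - tau.
have kappa0 : 0 <= kappa by rewrite le_max lexx.
have mu0 : 0 < mu.
  have : tau + 1 <= kappa by rewrite le_max lexx orbT.
  by rewrite /mu; lra.
pose W := mu^-1 *: (Z + kappa *: X).
have [y Ky sW] := s_att W.
have := GX W.
suff : s W < s X + inner G (W - X) by lra.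
have innerW u : mu * inner u W = inner u Z + kappa * inner u X.
  by rewrite /W innerZr mulrA divff ?gt_eqF// mul1r innerDr innerZr.
have EG : inner G (W - X) = inner G W - inner G X by rewrite innerBr.
rewrite sW sE EG -(ltr_pM2l mu0).
have := sep _ Ky; have := s_ub X _ Ky; rewrite sE => /(ler_wpM2l kappa0).
have := innerW (T y); have := innerW G; rewrite /mu; lra.
Qed.

(** * Attained maxima, the spectraplex, and the two implications *)

Lemma maximum_argmax {R : realType} {T : Type} (K : set T) (phi : T -> R) y :
  argmax K phi y -> maximum [set phi z | z in K] = phi y.
Proof.
move=> [Ky y_max]; rewrite /maximum; case: xgetP => [m -> [[z Kz zm] mub]|H].
  by apply/le_anti; rewrite -{1}zm y_max//= mub//; exists y.
by case: (H (phi y)); split; [exists y|move=> _ [z Kz <-]; exact: y_max].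
Qed.

Lemma compact_argmax {R : realType} {T : topologicalType} (K : set T)
    (phi : T -> R) :
  K !=set0 -> compact K -> continuous phi -> exists y, argmax K phi y.
Proof.
move=> K0 Kcpt phiC.
have [|y /set_mem Ky y_max] := compact_EVT_max K0 Kcpt (f := phi).
  exact: continuous_subspaceT.
by exists y; split=> // z Kz; exact/y_max/mem_set.
Qed.

Lemma spectraplex_convex (R : realType) (n : nat) :
  convex_set (spectraplex R n : set (symmx R n)).
Proof.
move=> X Y t /set_mem[trX pX] /set_mem[trY pY]; apply/mem_set.
have s0 : 0 <= t%:inum :> R by [].
have s1 : t%:inum <= 1 :> R by [].
have conv_val : symmx_val (t%:inum *: X + (1 - t%:inum) *: Y) =
    t%:inum *: symmx_val X + (1 - t%:inum) *: symmx_val Y by [].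
rewrite /conv /= /unstable.onem; split; rewrite conv_val.
  by rewrite mxtraceD !mxtraceZ trX trY !mulr1 addrC subrK.
move=> v; rewrite mulmxDr mulmxDl -!scalemxAr -!scalemxAl mxE.
rewrite [X in X + _]mxE [X in _ + X]mxE.
by apply: addr_ge0; apply: mulr_ge0; rewrite ?subr_ge0.
Qed.

Theorem lemma5 (R : realType) (n : nat) (V : euclideanType R) (K : set V)
    (f : symmx R n -> V -> R) (g : symmx R n -> R)
    (Kneq0 : K !=set0) (Kcompact : compact K) (Kconvex : convex_set K)
    (f_diff : forall z : symmx R n * V,
       differentiable (fun p : symmx R n * V => f p.1 p.2) z)
    (f_convex : forall y, K y -> convex_function setT (f ^~ y))
    (f_concave : forall X, spectraplex R n X -> convex_function K (fun y => - f X y))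
    (f_lip : lipschitz_partial_gradients f (spectraplex R n) K)
    (gE : forall X, g X = maximum [set f X y | y in K]) :
  (forall (Xs : symmx R n) (ys : V),
      saddle_point (spectraplex R n) K f Xs ys ->
      [/\ argmin (spectraplex R n) g Xs,
          subdifferential g Xs (gradX f Xs ys) &
          forall X, spectraplex R n X -> 0 <= inner (X - Xs) (gradX f Xs ys)])
  /\
  (forall (h : symmx R n -> R) (A : {linear symmx R n -> V}) (b : V),
      smooth h -> convex_function setT h ->
      (forall X y, f X y = h X + inner y (A X - b)) ->
      (forall X, g X = h X + maximum [set inner y (A X - b) | y in K]) ->
      forall Xs Gs : symmx R n,
      argmin (spectraplex R n) g Xs ->
      subdifferential g Xs Gs ->
      (forall X, spectraplex R n X -> 0 <= inner (X - Xs) Gs) ->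
      exists ys : V,
        [/\ argmax K (f Xs) ys,
            saddle_point (spectraplex R n) K f Xs ys &
            gradX f Xs ys = Gs]).
Proof.
have fX_diff X y : differentiable (f ^~ y) X.
  by apply: (@differentiable_comp _ _ _ _ (fun X => (X, y)) (fun p => f p.1 p.2)).
have fY_cont X : continuous (f X).
  move=> y; apply: differentiable_continuous.
  by apply: (@differentiable_comp _ _ _ _ (fun y => (X, y)) (fun p => f p.1 p.2)).
have gmax X y : argmax K (f X) y -> g X = f X y.
  by move=> ymax; rewrite gE (maximum_argmax K (f X) y ymax).
have f_att X : exists y, argmax K (f X) y by exact: compact_argmax.
have f_le_g X y : K y -> f X y <= g X.
  by have [z zmax] := f_att X; rewrite (gmax _ _ zmax) => Ky; exact: zmax.2.
split=> [Xs ys [SXs Kys saddle]|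
         h A b [hdiff _] _ fE _ Xs Gs [SXs _] Gs_sub Gs_ge0].
  have gXs : g Xs = f Xs ys.
    by apply: gmax; split=> // w Kw; exact: (saddle Xs w SXs Kw).1.
  split.
  - split=> // Z SZ; rewrite gXs; apply: le_trans (f_le_g Z ys Kys).
    exact: (saddle Z ys SZ Kys).2.
  - move=> Z; rewrite gXs; apply: le_trans (f_le_g Z ys Kys).
    exact: convex_gradient_le (f_convex _ Kys) (fX_diff _ _).
  (* The difference quotients of [f ^~ ys] from [Xs] towards [X] are nonnegative, as the segment
     stays in the spectraplex. *)
  - move=> X SX; rewrite ipC -gradE; apply: diff_ge => // t t0 t1.
    rewrite mulr0 subr_ge0; apply: (saddle _ ys _ Kys).2.
    exact: convex_set_line (@spectraplex_convex R n) SXs SX t0 t1.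
pose s X := g X - h X.
have s_att Z : exists2 y, K y & s Z = inner y (A Z - b).
  have [y ymax] := f_att Z; exists y; first exact: ymax.1.
  by rewrite /s (gmax _ _ ymax) fE addrAC subrr add0r.
have s_ub Z y : K y -> inner y (A Z - b) <= s Z.
  by move=> /(f_le_g Z); rewrite fE /s; lra.
have s_conv Z t : 0 < t -> t < 1 ->
    s (Xs + t *: (Z - Xs)) - s Xs <= t * (s Z - s Xs).
  (* A [y] optimal at the intermediate point gives a function affine along the segment, equal to [s]
     there and at most [s] at both ends. *)
  move=> t0 t1; have [y Ky ->] := s_att (Xs + t *: (Z - Xs)).
  have := s_ub Xs y Ky; have := s_ub Z y Ky.
  have AE : A (Xs + t *: (Z - Xs)) - b = A Xs - b + t *: ((A Z - b) - (A Xs - b)).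
    by rewrite linearD linearZ linearB /= addrAC opprB addrA subrK.
  have -> : inner y (A (Xs + t *: (Z - Xs)) - b) =
      inner y (A Xs - b) + t * (inner y (A Z - b) - inner y (A Xs - b)).
    by rewrite AE innerDr innerZr (innerBr y (A Z - b)).
  nra.
have s_sub : subdifferential s Xs (Gs - grad h Xs).
  move=> Z; rewrite innerBl.
  (* At [Xs + t *: (Z - Xs)], the subgradient inequality for g = h + s and [s_conv] bound the
     increment of [h] below by [t] times the left side. *)
  suff : inner Gs (Z - Xs) - (s Z - s Xs) <= inner (grad h Xs) (Z - Xs) by lra.
  rewrite -gradE.
  apply: diff_ge => // t t0 t1; have := s_conv Z t t0 t1.
  have := Gs_sub (Xs + t *: (Z - Xs)).
  rewrite addrAC subrr add0r innerZr /s; lra.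
have [ys [Kys ys_max ysA]] :=
  support_subgradient _ A b s Xs _ Kneq0 Kcompact Kconvex s_att s_ub s_sub.
have ys_argmax : argmax K (f Xs) ys.
  by split=> // w Kw; rewrite !fE lerD2l ys_max s_ub.
have gradE_ys : gradX f Xs ys = Gs.
  (* The linear part of [f ^~ ys - h] is Gs - grad h(Xs), so adding grad h(Xs) leaves [Gs]. *)
  have fysE : f ^~ ys = fun X => h X + (inner (Gs - grad h Xs) X + - inner ys b).
    by apply/funext => X; rewrite fE innerBr ysA.
  by rewrite /gradX fysE grad_add_affine// addrC subrK.
exists ys; split=> //; split=> // Z w SZ Kw; split; first exact: ys_argmax.2.
(* The variational inequality makes the first-order term of the convex function [f ^~ ys]
   nonnegative, so [Xs] minimizes it. *)
have : f Xs ys + inner (gradX f Xs ys) (Z - Xs) <= f Z ys.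
  exact: convex_gradient_le (f_convex _ Kys) (fX_diff _ _).
have := Gs_ge0 Z SZ; rewrite gradE_ys ipC; lra.
Qed.
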